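(* Let $\tilde A_i=(a_i;\,l_i^{\mu L},r_i^{\mu L},l_i^{\mu U},r_i^{\mu U};\,l_i^{\nu L},r_i^{\nu L},l_i^{\nu U},r_i^{\nu U})_{LR}$, $i=1,2$, be $LR$-type IVIFNs with the same shape functions, where $a_1+r_1^{\mu L}<0$ and $a_1+r_1^{\mu U}\ge0$, and $\tilde A_2$ is arbitrary. Then $\tilde A_1\odot\tilde A_2=(a;\,l^{\mu L},r^{\mu L},l^{\mu U},r^{\mu U};\,l^{\nu L},r^{\nu L},l^{\nu U},r^{\nu U})_{LR}$, where $a=a_1a_2$; for $\kappa=\mu L$, $$l^\kappa=a_1a_2-\min\{(a_1+r_1^\kappa)(a_2+r_2^\kappa),(a_1-l_1^\kappa)(a_2+r_2^\kappa)\},\quad r^\kappa=\max\{(a_1-l_1^\kappa)(a_2-l_2^\kappa),(a_1+r_1^\kappa)(a_2-l_2^\kappa)\}-a_1a_2;$$ and for each $\kappa\in\{\mu U,\nu L,\nu U\}$, $$l^\kappa=a_1a_2-\min\{(a_1-l_1^\kappa)(a_2+r_2^\kappa),(a_1+r_1^\kappa)(a_2-l_2^\kappa)\},\quad r^\kappa=\max\{(a_1+r_1^\kappa)(a_2+r_2^\kappa),(a_1-l_1^\kappa)(a_2-l_2^\kappa)\}-a_1a_2.$$ Moreover the conditions for an $LR$-type representation hold: all eight spreads of the product are positive and $l^{\mu U}\ge l^{\mu L}$, $l^{\nu L}\ge l^{\nu U}$, $l^{\nu L}\ge l^{\mu L}$, $l^{\nu U}\ge l^{\mu U}$, and likewise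 with $r$ in place of $l$.
   Context: A shape function is a continuous, strictly decreasing, invertible $f:[0,\infty)\to[0,1]$ with $f(0)=1$ and $\lim_{x\to\infty}f(x)=0$. Fix shape functions $L,R,L',R'$. An $LR$-type interval-valued intuitionistic fuzzy number (IVIFN) is written $\tilde A=(a;l^{\mu L},r^{\mu L},l^{\mu U},r^{\mu U};l^{\nu L},r^{\nu L},l^{\nu U},r^{\nu U})_{LR}$, where $a\in\mathbb R$ is its mean value and the eight spreads are positive reals with $l^{\mu U}\ge l^{\mu L}$, $r^{\mu U}\ge r^{\mu L}$, $l^{\nu L}\ge l^{\nu U}$, $r^{\nu L}\ge r^{\nu U}$, $l^{\nu L}\ge l^{\mu L}$, $r^{\nu L}\ge r^{\mu L}$, $l^{\nu U}\ge l^{\mu U}$, $r^{\nu U}\ge r^{\mu U}$. It encodes a lower membership function equal to $L((a-x)/l^{\mu L})$ on $[a-l^{\mu L},a]$, $R((x-a)/r^{\mu L})$ on $[a,a+r^{\mu L}]$, and $0$ otherwise; an upper membership function of the same form with $L',R',l^{\mu U},r^{\mu U}$; a lower non-membership function equal to $1-L((a-x)/l^{\nu L})$ on $[a-l^{\nu L},a]$, $1-R((x-a)/r^{\nu L})$ on $[a,a+r^{\nu L}]$, and $1$ otherwise; and an upper non-membership function of the same form with $L',R',l^{\nu U},r^{\nu U}$. At each $x$ the supremum of the membership interval plus the supremum of the non-membership interval is at most $1$. The product $\tilde A_1\odot\tilde A_2$ is formed cutwise by interval multiplication and read off at the level where the inverse shape functions equal $0$ (giving the mean) and at the level where they equal $1$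 (giving the spreads). That is, it is the tuple (with the same shape functions) with mean $a=a_1a_2$ and spreads determined, for each $\kappa\in\{\mu L,\mu U,\nu L,\nu U\}$, by $$[a-l^{\kappa},a+r^{\kappa}]=[a_1-l_1^{\kappa},a_1+r_1^{\kappa}]\times[a_2-l_2^{\kappa},a_2+r_2^{\kappa}],$$ where $I\times J=\{xy:x\in I,y\in J\}$. *)

(* Defs.v *)
From HB Require Import structures.
From mathcomp Require Import all_boot all_order all_algebra.
From mathcomp Require Import all_classical all_reals all_analysis.
Set Implicit Arguments.
Unset Strict Implicit.
Unset Printing Implicit Defensive.
Import Order.TTheory GRing.Theory Num.Theory.
Import numFieldNormedType.Exports.
Local Open Scope classical_set_scope.
Local Open Scope ring_scope.

(* A shape function has domain [0, +oo[; it is a total function here, whose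
   values at negative arguments are unconstrained and never used.  Being
   strictly decreasing with limit 0, it never vanishes: it is invertible as a
   map onto ]0, 1], not onto the whole codomain [0, 1]. *)
Record shape_function (R : realType) (f : R -> R) : Prop := {
  shape_range : forall x, 0 <= x -> 0 <= f x <= 1;
  shape_continuous : {within `[0, +oo[, continuous f};
  shape_decreasing : forall x y, 0 <= x -> x < y -> f y < f x;
  shape_invertible : set_bij `[0, +oo[ `]0, 1] f;
  shape0 : f 0 = 1;
  shape_limit : f x @[x --> +oo] --> (0 : R)
}.

Inductive band := muL | muU | nuL | nuU.

(* The data (a; l, r, ...)_LR.  The shape functions fL, fR, fL', fR' are
   parameters of the type, so tuples of one type share them; the
   conditions on the spreads are in [lr_ivifn], not in the tuple. *)
Record lr_tuple (R : realType) (fL fR fL' fR' : R -> R) := LRTuple {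
  mean : R;
  lspread : band -> R;
  rspread : band -> R
}.

Section LR.
Variables (R : realType) (fL fR fL' fR' : R -> R).
Implicit Types A : lr_tuple fL fR fL' fR'.

(* The two branches agree at x = a, since shape functions equal 1 at 0. *)
Definition lr_profile (f g : R -> R) (a l r x : R) : R :=
  if a - l <= x <= a then f ((a - x) / l)
  else if a <= x <= a + r then g ((x - a) / r)
  else 0.

Definition band_profile A (k : band) : R -> R :=
  match k with
  | muL | nuL => lr_profile fL fR (mean A) (lspread A k) (rspread A k)
  | muU | nuU => lr_profile fL' fR' (mean A) (lspread A k) (rspread A k)
  end.

Definition lower_membership A (x : R) : R := band_profile A muL x.
Definition upper_membership A (x : R) : R := band_profile A muU x.
Definition lower_nonmembership A (x : R) : R := 1 - band_profile A nuL x.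
Definition upper_nonmembership A (x : R) : R := 1 - band_profile A nuU x.

Definition membership A (x : R) : set R :=
  `[lower_membership A x, upper_membership A x].
Definition nonmembership A (x : R) : set R :=
  `[lower_nonmembership A x, upper_nonmembership A x].

Definition spread_conditions (s : band -> R) : Prop :=
  [/\ forall k, 0 < s k,
      s muL <= s muU,
      s nuU <= s nuL,
      s muL <= s nuL
    & s muU <= s nuU].

Definition lr_ivifn A : Prop :=
  [/\ spread_conditions (lspread A),
      spread_conditions (rspread A)
    & forall x, sup (membership A x) + sup (nonmembership A x) <= 1].

Definition band_interval A (k : band) : set R :=
  `[mean A - lspread A k, mean A + rspread A k].

Definition is_lr_product A1 A2 A : Prop :=
  mean A = mean A1 * mean A2 /\
  forall k, band_interval A k =
    [set x * y | x in band_interval A1 k & y in band_interval A2 k].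

End LR.

(* Main.v *)
(* A product of real intervals is connected, hence it is the interval spanned by
   its extreme values.  The tuple with these endpoints is the product; its bands
   inherit their nesting from those of the factors, and as [mean A1 < 0], moving
   the second factor alone already pushes the product strictly to both sides of
   [mean A1 * mean A2]. *)

Require Import Defs.
From HB Require Import structures.
From mathcomp Require Import all_boot all_order all_algebra.
From mathcomp Require Import all_classical all_reals all_analysis.
From mathcomp Require Import lra.
Set Implicit Arguments.
Unset Strict Implicit.
Import Order.TTheory GRing.Theory Num.Theory.
Import numFieldNormedType.Exports.
Local Open Scope classical_set_scope.
Local Open Scope ring_scope.

(** This unfolds to the set of products in [is_lr_product], so facts about it apply to the bands by
    conversion. *)
Definition interval_mul (R : realType) (p q c d : R) : set R :=
  [set x * y | x in `[p, q] & y in `[c, d]].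

Lemma interval_mul_subset (R : realType) (p q c d p' q' c' d' : R) :
  p' <= p -> q <= q' -> c' <= c -> d <= d' ->
  interval_mul p q c d `<=` interval_mul p' q' c' d'.
Proof.
move=> pp qq cc dd _ [x + [y + <-]]; rewrite /= !in_itv /= => /andP[px xq] /andP[cy yd].
exists x; first by rewrite /= in_itv /=; apply/andP; split; lra.
by exists y => //; rewrite /= in_itv /=; apply/andP; split; lra.
Qed.

(* Intermediate value theorem along the segment joining two points of the box. *)
Lemma interval_mul_convex (R : realType) (p q c d u v z : R) :
  interval_mul p q c d u -> interval_mul p q c d v -> u <= z <= v ->
  interval_mul p q c d z.
Proof.
move=> [x0 + [y0 + <-]] [x1 + [y1 + <-]]; rewrite /= !in_itv /=.
move=> /andP[px0 x0q] /andP[cy0 y0d] /andP[px1 x1q] /andP[cy1 y1d] /andP[uz zv].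
pose f (t : R) := (x0 + t * (x1 - x0)) * (y0 + t * (y1 - y0)).
have fc : continuous f.
  move=> t; apply: cvgM; apply: cvgD; try exact: cvg_cst.
    by apply: cvgM; [exact: cvg_id | exact: cvg_cst].
  by apply: cvgM; [exact: cvg_id | exact: cvg_cst].
have f0 : f 0 = x0 * y0 by rewrite /f !mul0r !addr0.
have f1 : f 1 = x1 * y1 by rewrite /f !mul1r !subrKC.
have [||t] := @IVT R f 0 1 z ler01.
- exact: continuous_subspaceT.
- by rewrite f0 f1 ge_min uz le_max zv orbT.
rewrite in_itv /= => /andP[t0 t1] <-.
exists (x0 + t * (x1 - x0)); first by rewrite /= in_itv /=; apply/andP; split; nra.
by exists (y0 + t * (y1 - y0)) => //; rewrite /= in_itv /=; apply/andP; split; nra.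
Qed.

(** As [lo] and [hi] are attained, convexity fills everything between them; each sign case then only
    has to bound the products. *)
Lemma interval_mul_itv (R : realType) (p q c d lo hi : R) :
  interval_mul p q c d lo -> interval_mul p q c d hi ->
  (forall x y, p <= x <= q -> c <= y <= d -> lo <= x * y <= hi) ->
  interval_mul p q c d = `[lo, hi]%classic.
Proof.
move=> Slo Shi bnd; apply/seteqP; split=> z /=; last first.
  by rewrite in_itv /=; exact: interval_mul_convex.
by move=> [x + [y + <-]]; rewrite /= !in_itv /=; exact: bnd.
Qed.

Lemma interval_mul_corners (R : realType) (p q c d : R) : p <= q -> c <= d ->
  [/\ interval_mul p q c d (p * c), interval_mul p q c d (p * d),
      interval_mul p q c d (q * c) & interval_mul p q c d (q * d)].
Proof.
move=> pq cd.
have [pp qq] : `[p, q]%classic p /\ `[p, q]%classic q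
  by rewrite /= !in_itv /= !lexx pq.
have [cc dd] : `[c, d]%classic c /\ `[c, d]%classic d
  by rewrite /= !in_itv /= !lexx cd.
by split; [exists p | exists p | exists q | exists q] => //;
  [exists c | exists d | exists c | exists d].
Qed.

(** Every [x] in [[p, q]] is negative, so [x * d <= x * y <= x * c]. Both bounds are linear in [x];
    the signs of [d] and [c] tell at which end of [[p, q]] they are extreme. *)
Lemma interval_mul_neg (R : realType) (p q c d : R) :
  p <= q -> q < 0 -> c <= d ->
  interval_mul p q c d =
    `[Num.min (q * d) (p * d), Num.max (p * c) (q * c)]%classic.
Proof.
move=> pq q0 cd; have [pc pd qc qd] := interval_mul_corners pq cd.
apply: interval_mul_itv; [by case: leP | by case: leP |].
move=> x y /andP[px xq] /andP[cy yd]; rewrite ge_min le_max.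
apply/andP; split; apply/orP.
- by case: (leP 0 d) => d0; [right | left]; nra.
- by case: (leP 0 c) => c0; [right | left]; nra.
Qed.

(** The sign of [x] bounds [x * y] by [x] times an endpoint of [[c, d]]. Either a corner on the same
    side of 0 dominates this bound, or 0 separates the bound from the other corner. *)
Lemma interval_mul_straddle (R : realType) (p q c d : R) :
  p <= 0 -> 0 <= q -> c <= d ->
  interval_mul p q c d =
    `[Num.min (p * d) (q * c), Num.max (q * d) (p * c)]%classic.
Proof.
move=> p0 q0 cd; have [pc pd qc qd] := interval_mul_corners (le_trans p0 q0) cd.
apply: interval_mul_itv; [by case: leP | by case: leP |].
move=> x y /andP[px xq] /andP[cy yd]; rewrite ge_min le_max.
case: (leP 0 x) => x0.
- have xc : x * c <= x * y by rewrite ler_wpM2l.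
  have xd : x * y <= x * d by rewrite ler_wpM2l.
  apply/andP; split; apply/orP.
  + by case: (leP 0 c) => c0; [left | right]; nra.
  + by case: (leP 0 d) => d0; [left | right]; nra.
- have xc : x * y <= x * c by rewrite ler_wnM2l // ltW.
  have xd : x * d <= x * y by rewrite ler_wnM2l // ltW.
  apply/andP; split; apply/orP.
  + by case: (leP 0 d) => d0; [left | right]; nra.
  + by case: (leP 0 c) => c0; [left | right]; nra.
Qed.

(** One nonempty side suffices: [a] and [b] lie in the second interval, which is then nonempty too
    and has its endpoints in the first. *)
Lemma set_itvcc_inj (R : realType) (a b a' b' : R) :
  a <= b -> `[a, b]%classic = `[a', b']%classic -> a = a' /\ b = b'.
Proof.
move=> ab E.
have : `[a, b]%classic a by rewrite /= in_itv /= lexx.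
have : `[a, b]%classic b by rewrite /= in_itv /= lexx andbT.
rewrite E /= !in_itv /= => /andP[a'b bb'] /andP[a'a ab'].
have : `[a', b']%classic a' by rewrite /= in_itv /= lexx; lra.
have : `[a', b']%classic b' by rewrite /= in_itv /= lexx andbT; lra.
rewrite -E /= !in_itv /= => /andP[_ b'b] /andP[aa' _].
by split; apply/le_anti/andP; split.
Qed.

(** If [b < a] the interval is empty and its [sup] is 0 by convention; [0 <= b] covers this case. *)
Lemma sup_itvcc_le (R : realType) (a b : R) : 0 <= b -> sup `[a, b] <= b.
Proof.
move=> b0; case: (leP a b) => ab; first by rewrite sup_itv //= bnd_simp.
by rewrite set_itv_ge ?sup0 // bnd_simp -ltNge.
Qed.

Lemma shape_nonincreasing (R : realType) (f : R -> R) (x y : R) :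
  shape_function f -> 0 <= x -> x <= y -> f y <= f x.
Proof.
move=> hf x0; rewrite le_eqVlt => /predU1P[->//|xy].
exact/ltW/(shape_decreasing hf).
Qed.

Lemma lr_profile_range (R : realType) (f g : R -> R) (a l r x : R) :
  shape_function f -> shape_function g -> 0 < l -> 0 < r ->
  0 <= lr_profile f g a l r x <= 1.
Proof.
move=> hf hg l0 r0; rewrite /lr_profile.
case: ifPn => [/andP[_ xa]|_].
  by apply: (shape_range hf); rewrite divr_ge0 ?subr_ge0 // ltW.
case: ifPn => [/andP[ax _]|_]; last by rewrite lexx ler01.
by apply: (shape_range hg); rewrite divr_ge0 ?subr_ge0 // ltW.
Qed.

(** Widening a spread shrinks the argument of a nonincreasing shape function. Outside the narrower
    support the left side is 0. *)
Lemma lr_profile_le (R : realType) (f g : R -> R) (a l r l' r' x : R) :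
  shape_function f -> shape_function g -> 0 < l -> 0 < r -> l <= l' -> r <= r' ->
  lr_profile f g a l r x <= lr_profile f g a l' r' x.
Proof.
move=> hf hg l0 r0 ll rr.
have l'0 := lt_le_trans l0 ll; have r'0 := lt_le_trans r0 rr.
have /andP[p0 _] := lr_profile_range a x hf hg l'0 r'0.
rewrite {1}/lr_profile; case: ifPn => [/andP[alx xa]|nl].
  rewrite /lr_profile (_ : a - l' <= x <= a); last by rewrite xa andbT; lra.
  apply: (shape_nonincreasing hf); first by rewrite divr_ge0 ?subr_ge0 // ltW.
  by rewrite ler_wpM2l ?subr_ge0 // lef_pV2.
case: ifPn => [/andP[ax xr]|//].
(* The point [x = a] belongs to the first branch, so here [x] is strictly to the right of [a] and
   the wider profile takes its right branch as well. *)
have xa : a < x by rewrite lt_neqAle ax andbT; apply: contra nl => /eqP <-; lra.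
rewrite /lr_profile [x <= a]leNgt xa andbF ax (_ : x <= a + r'); last by lra.
apply: (shape_nonincreasing hg); first by rewrite divr_ge0 ?subr_ge0 // ltW.
by rewrite ler_wpM2l ?subr_ge0 // lef_pV2.
Qed.

(* The upper membership and upper non-membership functions share their shape
   functions, so [muU <= nuU] for the spreads gives the supremum condition. *)
Lemma lr_ivifn_spreads (R : realType) (fL fR fL' fR' : R -> R)
    (A : lr_tuple fL fR fL' fR') :
  shape_function fL' -> shape_function fR' ->
  spread_conditions (lspread A) -> spread_conditions (rspread A) -> lr_ivifn A.
Proof.
move=> hfL' hfR' hl hr; split=> // x.
have [l0 _ _ _ lU] := hl; have [r0 _ _ _ rU] := hr.
have /andP[m0 _] := lr_profile_range (mean A) x hfL' hfR' (l0 muU) (r0 muU).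
have /andP[_ n1] := lr_profile_range (mean A) x hfL' hfR' (l0 nuU) (r0 nuU).
have mn := lr_profile_le (mean A) x hfL' hfR' (l0 muU) (r0 muU) lU rU.
have m := sup_itvcc_le (lower_membership A x) m0.
have n := sup_itvcc_le (lower_nonmembership A x) (etrans (subr_ge0 _ _) n1).
rewrite /membership /nonmembership /upper_membership /upper_nonmembership /=.
by apply: le_trans (lerD m n) _; lra.
Qed.

(** The mean is prescribed and each band determines its endpoints, hence the spreads. Positivity for
    [A] alone makes the bands nonempty. *)
Lemma is_lr_product_unique (R : realType) (fL fR fL' fR' : R -> R)
    (A1 A2 A A' : lr_tuple fL fR fL' fR') :
  (forall k, 0 < lspread A k) -> (forall k, 0 < rspread A k) ->
  is_lr_product A1 A2 A -> is_lr_product A1 A2 A' -> A = A'.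
Proof.
move=> l0 r0 [mA pA] [mA' pA'].
have E k : lspread A k = lspread A' k /\ rspread A k = rspread A' k.
  have := pA k; rewrite -(pA' k) /band_interval => /set_itvcc_inj.
  move: (l0 k) (r0 k) => lk rk []; first by lra.
  by rewrite mA mA' => hl hr; split; lra.
have ml : mean A = mean A' by rewrite mA mA'.
have ll : lspread A = lspread A' by apply/funext => k; have [] := E k.
have rr : rspread A = rspread A' by apply/funext => k; have [] := E k.
by move: ml ll rr; case: (A) => ? ? ?; case: (A') => ? ? ? /= -> -> ->.
Qed.

Lemma lr_product_ivifn (R : realType) (fL fR fL' fR' : R -> R)
    (A1 A2 A : lr_tuple fL fR fL' fR') :
  shape_function fL' -> shape_function fR' -> lr_ivifn A1 -> lr_ivifn A2 ->
  mean A1 < 0 -> is_lr_product A1 A2 A -> lr_ivifn A.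
Proof.
move=> hfL' hfR' [hl1 hr1 _] [hl2 hr2 _] a0 [mA pA].
have [l10 ll1 ll2 ll3 ll4] := hl1; have [r10 rr1 rr2 rr3 rr4] := hr1.
have [l20 lm1 lm2 lm3 lm4] := hl2; have [r20 rm1 rm2 rm3 rm4] := hr2.
have pos k : 0 < lspread A k /\ 0 < rspread A k.
  have := l10 k; have := r10 k; have := l20 k; have := r20 k => r2 l2 r1 l1.
  (* Since [mean A1 < 0], the first of these products is below [mean A] and the second is above
     it. *)
  have [] : band_interval A k (mean A1 * (mean A2 + rspread A2 k)) /\
            band_interval A k (mean A1 * (mean A2 - lspread A2 k)).
    rewrite pA; split; exists (mean A1); rewrite /band_interval /= ?in_itv /=;
      by [lra | eexists; last reflexivity; rewrite /= in_itv /=; lra].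
  by rewrite /band_interval /= !in_itv /= mA => /andP[h1 _] /andP[_ h2]; split; nra.
have mono k k' : lspread A1 k <= lspread A1 k' -> rspread A1 k <= rspread A1 k' ->
    lspread A2 k <= lspread A2 k' -> rspread A2 k <= rspread A2 k' ->
    lspread A k <= lspread A k' /\ rspread A k <= rspread A k'.
  move=> l1 r1 l2 r2; have [lk rk] := pos k.
  (* Both bands of [A] are measured from the same mean, so their inclusion compares the spreads. *)
  have sub : band_interval A k `<=` band_interval A k'.
    by rewrite !pA; apply: interval_mul_subset; lra.
  have := sub (mean A - lspread A k); have := sub (mean A + rspread A k).
  rewrite /band_interval /= !in_itv /= => h1 h2.
  have /h1 /andP[_ h1'] : mean A - lspread A k <= mean A + rspread A k <=
      mean A + rspread A k by lra.
  have /h2 /andP[h2' _] : mean A - lspread A k <= mean A - lspread A k <=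
      mean A + rspread A k by lra.
  by split; lra.
have [m1l m1r] := mono _ _ ll1 rr1 lm1 rm1.
have [m2l m2r] := mono _ _ ll2 rr2 lm2 rm2.
have [m3l m3r] := mono _ _ ll3 rr3 lm3 rm3.
have [m4l m4r] := mono _ _ ll4 rr4 lm4 rm4.
by apply: lr_ivifn_spreads => //; split=> // k; have [] := pos k.
Qed.

Theorem proposition3p1p8 (R : realType) (fL fR fL' fR' : R -> R)
    (hfL : shape_function fL) (hfR : shape_function fR)
    (hfL' : shape_function fL') (hfR' : shape_function fR')
    (A1 A2 : lr_tuple fL fR fL' fR')
    (hA1 : lr_ivifn A1) (hA2 : lr_ivifn A2)
    (hmuL : mean A1 + rspread A1 muL < 0)
    (hmuU : 0 <= mean A1 + rspread A1 muU) :
  exists A : lr_tuple fL fR fL' fR',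
    [/\ unique (is_lr_product A1 A2) A,
        mean A = mean A1 * mean A2,
        lspread A muL = mean A1 * mean A2 -
            Num.min ((mean A1 + rspread A1 muL) * (mean A2 + rspread A2 muL))
                    ((mean A1 - lspread A1 muL) * (mean A2 + rspread A2 muL)) /\
        rspread A muL =
            Num.max ((mean A1 - lspread A1 muL) * (mean A2 - lspread A2 muL))
                    ((mean A1 + rspread A1 muL) * (mean A2 - lspread A2 muL))
            - mean A1 * mean A2,
        (forall k : band, k <> muL ->
          lspread A k = mean A1 * mean A2 -
            Num.min ((mean A1 - lspread A1 k) * (mean A2 + rspread A2 k))
                    ((mean A1 + rspread A1 k) * (mean A2 - lspread A2 k)) /\
          rspread A k =
            Num.max ((mean A1 + rspread A1 k) * (mean A2 + rspread A2 k))
                    ((mean A1 - lspread A1 k) * (mean A2 - lspread A2 k))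
            - mean A1 * mean A2)
      & lr_ivifn A].
Proof.
set a1 := mean A1; set a2 := mean A2.
pose lo (k : band) : R := match k with
  | muL => Num.min ((a1 + rspread A1 muL) * (a2 + rspread A2 muL))
                   ((a1 - lspread A1 muL) * (a2 + rspread A2 muL))
  | _ => Num.min ((a1 - lspread A1 k) * (a2 + rspread A2 k))
                 ((a1 + rspread A1 k) * (a2 - lspread A2 k))
  end.
pose hi (k : band) : R := match k with
  | muL => Num.max ((a1 - lspread A1 muL) * (a2 - lspread A2 muL))
                   ((a1 + rspread A1 muL) * (a2 - lspread A2 muL))
  | _ => Num.max ((a1 + rspread A1 k) * (a2 + rspread A2 k))
                 ((a1 - lspread A1 k) * (a2 - lspread A2 k))
  end.
pose A : lr_tuple fL fR fL' fR' :=
  LRTuple fL fR fL' fR' (a1 * a2) (fun k => a1 * a2 - lo k) (fun k => hi k - a1 * a2).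
have [[l10 _ _ _ _] [r10 _ rnu _ rU] _] := hA1.
have [[l20 _ _ _ _] [r20 _ _ _ _] _] := hA2.
have a1_lt0 : a1 < 0 by have := r10 muL; rewrite /a1; lra.
have prodA : is_lr_product A1 A2 A.
  split=> // k; rewrite /band_interval /= subKr subrKC.
  have := l10 k; have := r10 k; have := l20 k; have := r20 k => r2 l2 r1 l1.
  (* On [muL] the first factor is negative. On the other bands it straddles 0: the right spreads of
     [A1] satisfy [muU <= nuU <= nuL], so [hmuU] passes to all three. *)
  apply/esym; case: k r2 l2 r1 l1 => r2 l2 r1 l1;
    by [apply: interval_mul_neg; lra
       | apply: interval_mul_straddle; rewrite -/a1; move: hmuU; rewrite -/a1; lra].
have ivA := lr_product_ivifn hfL' hfR' hA1 hA2 a1_lt0 prodA.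
exists A; split=> //.
- split=> // A' prodA'; have [[lA _ _ _ _] [rA _ _ _ _] _] := ivA.
  exact: is_lr_product_unique lA rA prodA prodA'.
- by case.
Qed.
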